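(* Let $\theta_1,\dots,\theta_r$ be real numbers, with $H_\theta$ as defined in the context. Let $f_1,\dots,f_D\in\mathbb{C}(X_1,\dots,X_r)$ be pairwise distinct, real-valued and without poles on $\mathbb{T}^r$, let $F_j(t)=f_j(e^{i\theta_1t},\dots,e^{i\theta_rt})$ for $1\le j\le D$, and let $G=(G_1,\dots,G_D):t\mapsto(F_1(t),\dots,F_D(t))+o(1)\in\mathbb{R}^D$ as $t\to+\infty$. If there exists $z\in H_\theta$ such that $f_1(z)>\dots>f_D(z)$, then $0<\underline{\delta}(G_1>\dots>G_D)$. Also, if there exists $z\in H_\theta$ such that $f_1(z)\ge\dots\ge f_D(z)$ does not hold, then $\overline{\delta}(G_1>\dots>G_D)<1$. In particular, if there exists $y\in\mathbb{R}$ such that $F_1(y)>\dots>F_D(y)$, then $0<\underline{\delta}(G_1>\dots>G_D)$, and if there exists $n\in\mathbb{Z}$ such that $F_1(n)\ge\dots\ge F_D(n)$ does not hold, then $\overline{\delta}(G_1>\dots>G_D)<1$.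
   Context: $\mathbb{T}=\{z\in\mathbb{C}:|z|=1\}$. All functions of a real variable are Lebesgue measurable. A rational function has no pole on $\mathbb{T}^r$ if it can be written $P/Q$ with polynomials $P,Q$ such that $Q$ does not vanish on $\mathbb{T}^r$; it is real-valued on $\mathbb{T}^r$ if it takes real values there. $\underline{\delta}(G_1>\dots>G_D)$ and $\overline{\delta}(G_1>\dots>G_D)$ are the $\liminf$ and $\limsup$ as $X\to+\infty$ of $\frac1X\int_0^X\mathbf{1}_{x_1>\dots>x_D}(G_1(y),\dots,G_D(y))\,\mathrm{d}y$, where $\mathbf{1}_{x_1>\dots>x_D}$ is the indicator of $\{x\in\mathbb{R}^D:x_1>\dots>x_D\}$. Let $m=\dim_{\mathbb{Q}}\mathrm{Span}_{\mathbb{Q}}(\theta_1,\dots,\theta_r)$. After reindexing the $\theta_i$ (and correspondingly the variables $X_i$), it is assumed that $\{\theta_1,\dots,\theta_m\}$ is a basis of this $\mathbb{Q}$-vector space, and one writes $\theta_j=\sum_{k=1}^m b_{k,j}\theta_k$ for $m+1\le j\le r$, with $b_{k,j}\in\mathbb{Q}$. Let $d\ge1$ be the least common multiple of the denominators of all the $b_{k,j}$ ($d=1$ if $m=r$), $h_{k,j}=d\,b_{k,j}\in\mathbb{Z}$, and $$H_\theta=\left\{\left(z_1^d,\dots,z_m^d,\prod_{k=1}^m z_k^{h_{k,m+1}},\dots,\prod_{k=1}^m z_k^{h_{k,r}}\right):(z_1,\dots,z_m)\in\mathbb{T}^m\right\}.$$ *)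

(* Defs.v *)
From HB Require Import structures.
From mathcomp Require Import all_boot all_order all_algebra.
From mathcomp Require Import complex.
From mathcomp Require Import -(notations) mpoly.
From mathcomp Require Import all_classical all_reals all_analysis.
Set Implicit Arguments.
Unset Strict Implicit.
Unset Printing Implicit Defensive.
Import Order.TTheory GRing.Theory Num.Theory.
Import numFieldNormedType.Exports.
Local Open Scope classical_set_scope.
Local Open Scope ring_scope.

Definition expi {R : realType} (x : R) : R[i] := Complex (cos x) (sin x).

Definition torus {R : realType} {n : nat} : set ('I_n -> R[i]) :=
  [set z | forall k, `|z k| = 1].

Definition cpoly (R : realType) (r : nat) := mpoly r R[i].

Definition ratfun (R : realType) (r : nat) := {fraction cpoly R r}.

Definition no_pole_on_torus {R : realType} {r : nat} (f : ratfun R r) : Prop :=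
  exists P Q : cpoly R r, f = tofrac P / tofrac Q /\
    forall z, torus z -> meval z Q != 0.

(* Fractions carry no canonical numerator and denominator. The value does not
   depend on P and Q (lemma ratvalE); it is 0 when no such Q exists. *)
Definition ratval {R : realType} {r : nat} (f : ratfun R r)
    (z : 'I_r -> R[i]) : R[i] :=
  xget 0 [set w | exists P Q : cpoly R r,
    [/\ f = tofrac P / tofrac Q, meval z Q != 0 &
        w = meval z P / meval z Q]].

Lemma ratvalE (R : realType) (r : nat) (P Q : cpoly R r) (z : 'I_r -> R[i]) :
  meval z Q != 0 ->
  ratval (tofrac P / tofrac Q) z = meval z P / meval z Q.
Proof.
move=> Qz; apply: xget_unique; first by exists P, Q.
move=> _ [P' [Q' [e Q'z ->]]].
have nz (q : cpoly R r) : meval z q != 0 -> tofrac q != 0.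
  by move=> qz; rewrite tofrac_eq0; apply: contraNneq qz => ->; rewrite meval0.
move/eqP: e; rewrite eqr_div ?nz// -!tofracM tofrac_eq => /eqP e.
by apply/eqP; rewrite eqr_div// -!mevalM e.
Qed.

Definition real_on_torus {R : realType} {r : nat} (f : ratfun R r) : Prop :=
  forall z, torus z -> ratval f z \is Num.real.

Definition realval {R : realType} {r : nat} (f : ratfun R r)
    (z : 'I_r -> R[i]) : R := complex.Re (ratval f z).

Definition along {R : realType} {r : nat} (theta : 'I_r -> R)
    (f : ratfun R r) (t : R) : R :=
  realval f (fun k => expi (theta k * t)).

Definition decr {R : realType} {D : nat} (x : 'I_D -> R) : Prop :=
  forall i j : 'I_D, j = i.+1 :> nat -> x i > x j.

Definition nonincr {R : realType} {D : nat} (x : 'I_D -> R) : Prop :=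
  forall i j : 'I_D, j = i.+1 :> nat -> x i >= x j.

(* The real line with the sigma-algebra of Lebesgue (not just Borel) measurable
   sets, on which completed_lebesgue_measure is defined. *)
Notation lebesgueR R := (caratheodory_type (@wlength R idfun)^*%mu).

Definition lebesgue_measurable {R : realType} (g : R -> R) : Prop :=
  measurable_fun (setT : set (lebesgueR R)) (g : lebesgueR R -> R).

Definition mean_decr {R : realType} {D : nat} (G : R -> 'I_D -> R) (X : R) :
    \bar R :=
  ((X^-1)%:E * \int[@completed_lebesgue_measure R]_(y in `[0%R, X])
                 (\1_[set t | decr (G t)] y)%:E)%E.

Definition lower_density {R : realType} {D : nat} (G : R -> 'I_D -> R) :
  \bar R := limf_einf (mean_decr G) (pinfty_nbhs R).

Definition upper_density {R : realType} {D : nat} (G : R -> 'I_D -> R) :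
  \bar R := limf_esup (mean_decr G) (pinfty_nbhs R).

Definition Qspan {R : realType} {n : nat} (u : 'I_n -> R) : set R :=
  [set x | exists q : 'I_n -> rat, x = \sum_k ratr (q k) * u k].

Definition Qfree {R : realType} {n : nat} (u : 'I_n -> R) : Prop :=
  forall q : 'I_n -> rat, \sum_k ratr (q k) * u k = 0 -> forall k, q k = 0.

(* sigma is the reindexing of the theta's (so r = m + s), after which the first
   m of them form a Q-basis of their span (so m is its dimension) and the last
   s of them have coordinates b. *)
Definition Qbasis_reindexing {R : realType} {r m s : nat} (theta : 'I_r -> R)
    (sigma : 'I_(m + s) -> 'I_r) (b : 'I_m -> 'I_s -> rat) : Prop :=
  let u k := theta (sigma (lshift s k)) in
  [/\ bijective sigma, Qfree u, Qspan u = Qspan theta &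
      forall j, theta (sigma (rshift m j)) = \sum_k ratr (b k j) * u k].

Definition common_denom {m s : nat} (b : 'I_m -> 'I_s -> rat) : nat :=
  \big[lcmn/1%N]_(k < m) \big[lcmn/1%N]_(j < s) `|denq (b k j)|%N.

(* The rational under numq is an integer. *)
Definition hcoef {m s : nat} (b : 'I_m -> 'I_s -> rat) (k : 'I_m) (j : 'I_s) :
  int := numq ((common_denom b)%:R * b k j).

(* H_theta in the original coordinates: z \o sigma is the reindexed point. *)
Definition Htheta {R : realType} {r m s : nat} (sigma : 'I_(m + s) -> 'I_r)
    (b : 'I_m -> 'I_s -> rat) : set ('I_r -> R[i]) :=
  [set z | exists2 w : 'I_m -> R[i], torus w &
    (forall k, z (sigma (lshift s k)) = w k ^+ common_denom b) /\
    (forall j, z (sigma (rshift m j)) = \prod_k w k ^ hcoef b k j)].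

(* Main.v *)
Require Import Defs.
From mathcomp Require Import all_boot all_order all_algebra.
From mathcomp Require Import complex ring lra.
From mathcomp Require Import -(notations) mpoly.
From mathcomp Require Import all_classical all_reals all_analysis.
From mathcomp Require Import measurable_realfun.
Set Implicit Arguments.
Unset Strict Implicit.
Unset Printing Implicit Defensive.
Import Order.TTheory GRing.Theory Num.Theory.
Import numFieldNormedType.Exports.
Local Open Scope classical_set_scope.
Local Open Scope ring_scope.

(** The point t |-> (e^(i theta_1 t), ..., e^(i theta_r t)) of the torus spends
    a positive proportion of its time near z as soon as z satisfies every
    multiplicative relation that the integer relations between the theta_k
    impose on the orbit ([respects_relations]).  Points of H_theta do, because
    the first m frequencies are free over the rationals, and points of the
    orbit do trivially, so both halves of the theorem are the same statement.

    The positive proportion comes from averaging a peak function, which avoids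
    any separate density theorem of Kronecker type.  With
    u_k(t) = e^(i theta_k t) conj(z_k), let
    [[
      peak(t) = prod_k ((1 + Re u_k(t)) / 2) ^ p
              = | prod_k ((1 + u_k(t)) / 2) ^ p |^2.
    ]]
    It takes values in [0, 1], and once some u_k(t) has real part at most
    1 - eta it is at most (1 - eta/2)^p.  Expanding the square by the binomial
    theorem gives a trigonometric sum whose terms of frequency zero all have
    nonnegative coefficients, precisely because z respects the relations; its
    mean is then at least the sum of the squared binomial weights, hence at
    least (p+1)^(-r) by Cauchy-Schwarz ([peak_trig]).  The terms of nonzero
    frequency have bounded primitives and do not contribute to the mean
    ([trig_sum_integral_ge]).  For large p the mean (p+1)^(-r) exceeds
    (1 - eta/2)^p, so the times near z have positive lower density
    ([near_times_lebesgue]).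

    The f_j are continuous on the torus, having no poles there, so if the values
    f_j(z) are strictly decreasing, those of G(t) are too for all large t near z
    ([asymp_near]); this bounds the lower density from below.  If two
    consecutive f_j(z) are in strictly increasing order, the times near z
    eventually lie in the complement, which bounds the upper density away from 1. *)

(** * Unit complex numbers *)

Section UnitComplex.
Variable R : realType.
Implicit Types (x y : R) (u z : R[i]).

Lemma expiD x y : expi (x + y) = expi x * expi y.
Proof.
rewrite /expi cosD sinD; apply/eqP; rewrite eq_complex /=.
by rewrite eqxx /= [cos x * _ + _]addrC.
Qed.

Lemma expi0 : expi (0 : R) = 1.
Proof. by rewrite /expi cos0 sin0. Qed.

Lemma expiX x n : expi (n%:R * x) = expi x ^+ n.
Proof.
elim: n => [|n IHn]; first by rewrite mul0r expi0.
by rewrite exprS -IHn -expiD mulrSr mulrDl mul1r addrC.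
Qed.

Lemma expi_sum (I : Type) (s : seq I) (P : pred I) (F : I -> R) :
  expi (\sum_(i <- s | P i) F i) = \prod_(i <- s | P i) expi (F i).
Proof. exact: (big_morph _ expiD expi0). Qed.

Lemma conjcM u z : (u * z)^*%C = u^*%C * z^*%C.
Proof. exact: rmorphM. Qed.

Lemma conjc_expi x : (expi x)^*%C = expi (- x).
Proof. by rewrite /expi cosN sinN. Qed.

Lemma norm_expi x : `|expi x| = 1.
Proof. by rewrite normc_def /= cos2Dsin2 sqrtr1. Qed.

Lemma mul_conjc1 z : `|z| = 1 -> z * z^*%C = 1.
Proof. by move=> z1; rewrite -sqr_normc z1 expr1n. Qed.

Lemma Re_norm_le1 z : `|z| = 1 -> -1 <= complex.Re z <= 1.
Proof.
by move=> z1; have := normc_ge_Re z; rewrite z1 (lecR _ 1) ler_norml.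
Qed.

Lemma Re_sum (I : Type) (s : seq I) (P : pred I) (F : I -> R[i]) :
  complex.Re (\sum_(i <- s | P i) F i) = \sum_(i <- s | P i) complex.Re (F i).
Proof. by apply: (big_morph (@complex.Re R)) => // -[? ?] [? ?]. Qed.

Lemma Re_mulC x z : complex.Re (x%:C%C * z) = x * complex.Re z.
Proof. by case: z => a b /=; rewrite mul0r subr0. Qed.

(** This is (1 + cos x) / 2 = |(1 + e^(ix)) / 2|^2: it turns the real peak
    function below into a square that can be expanded by the binomial theorem. *)
Lemma half_angle u : `|u| = 1 ->
  ((1 + complex.Re u) / 2)%:C%C = ((1 + u) / 2) * ((1 + u) / 2)^*%C.
Proof.
move=> u1.
have -> : ((1 + u) / 2)^*%C = (1 + u^*%C) / 2.
  by rewrite (rmorphM (@conjc R)) rmorphD rmorph1 fmorphV rmorph_nat.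
have -> : (1 + u) / 2 * ((1 + u^*%C) / 2) = (1 + u + u^*%C + u * u^*%C) / 4.
  by field.
rewrite mul_conjc1// (rmorphM (real_complex R)) rmorphD rmorph1 fmorphV.
rewrite rmorph_nat /= ReJ_add.
by field.
Qed.

(** The case of Cauchy-Schwarz against the constant vector: the difference of
    the two sides is the sum of the (a_i - 1/#|I|)^2. *)
Lemma sum_sqr_ge_inv_card (I : finType) (a : I -> R) (i0 : I) :
  \sum_i a i = 1 -> (#|I|%:R)^-1 <= \sum_i a i ^+ 2.
Proof.
move=> a1; set N : R := #|I|%:R.
have N0 : 0 < N by rewrite ltr0n; apply/card_gt0P; exists i0.
rewrite -subr_ge0; suff -> : \sum_i a i ^+ 2 - N^-1 = \sum_i (a i - N^-1) ^+ 2.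
  by apply: sumr_ge0 => i _; exact: sqr_ge0.
under [RHS]eq_bigr do rewrite sqrrB.
rewrite big_split sumrB /= sumr_const sumrMnl -mulr_suml a1 mul1r.
by rewrite -mulr_natr -/N; field; rewrite gt_eqF.
Qed.
End UnitComplex.

(** * The peak function and its expansion *)

Section Peak.
Variables (R : realType) (r : nat).
Implicit Types (theta : 'I_r -> R) (z : 'I_r -> R[i]).

(** Exponents are naturals, so that no inverses appear: an integer relation
    between the theta_k is split into its positive and negative parts n and m. *)
Definition respects_relations theta z :=
  forall n m : 'I_r -> nat,
    \sum_k (n k)%:R * theta k = \sum_k (m k)%:R * theta k ->
    \prod_k z k ^+ n k = \prod_k z k ^+ m k.

Definition peak theta z p (t : R) : R :=
  \prod_k ((1 + complex.Re (expi (theta k * t) * (z k)^*%C)) / 2) ^+ p.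

Lemma prod_binomial p (u : 'I_r -> R[i]) :
  \prod_k ((1 + u k) / 2) ^+ p =
  \sum_(n : {ffun 'I_r -> 'I_p.+1})
    (\prod_k ('C(p, n k)%:R / 2 ^+ p))%:C%C * \prod_k u k ^+ n k.
Proof.
have binomial (v : R[i]) : ((1 + v) / 2) ^+ p =
    \sum_(j < p.+1) 'C(p, j)%:R / 2 ^+ p * v ^+ j.
  rewrite expr_div_n exprDn mulr_suml; apply: eq_bigr => j _.
  by rewrite expr1n mul1r -mulr_natl mulrAC.
under eq_bigr do rewrite binomial.
rewrite bigA_distr_bigA /=; apply: eq_bigr => n _.
rewrite big_split /= rmorph_prod; congr (_ * _); apply: eq_bigr => k _.
by rewrite rmorphM fmorphV rmorphXn !rmorph_nat.
Qed.

Lemma sum_binomial_weights p :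
  \sum_(n : {ffun 'I_r -> 'I_p.+1}) \prod_k ('C(p, n k)%:R / 2 ^+ p) = 1 :> R.
Proof.
rewrite -(bigA_distr_bigA (fun _ (j : 'I_p.+1) => 'C(p, j)%:R / 2 ^+ p)) /=.
rewrite big1// => k _; rewrite -mulr_suml.
have -> : \sum_(i < p.+1) 'C(p, i)%:R = 2 ^+ p :> R.
  rewrite -[2]/(1 + 1) exprDn; apply: eq_bigr => i _.
  by rewrite !expr1n mul1r.
by rewrite divff// expf_neq0// pnatr_eq0.
Qed.

(** Squaring [prod_binomial] produces one term for each pair (n, m) of
    exponents, of frequency sum_k (n_k - m_k) theta_k.  When that frequency is 0
    the monomials of z for n and m agree, so their phases cancel and the
    coefficient is the product of two binomial weights, which is nonnegative;
    the diagonal n = m alone already gives the bound. *)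
Lemma peak_trig theta z p : torus z -> respects_relations theta z ->
  exists (I : finType) (lam : I -> R) (c : I -> R[i]),
    (forall t, peak theta z p t = \sum_i complex.Re (c i * expi (lam i * t)))
    /\ ((p.+1 ^ r)%:R)^-1 <= \sum_(i | lam i == 0) complex.Re (c i).
Proof.
move=> zT zrel.
pose N := {ffun 'I_r -> 'I_p.+1}.
pose a (n : N) : R := \prod_k ('C(p, n k)%:R / 2 ^+ p).
pose w (n : N) : R := \sum_k (n k)%:R * theta k.
pose Z (n : N) : R[i] := \prod_k z k ^+ n k.
have a0 n : 0 <= a n.
  by apply: prodr_ge0 => k _; rewrite divr_ge0 ?exprn_ge0.
have Zn n : `|Z n| = 1.
  by rewrite normr_prod big1// => k _; rewrite normrX zT expr1n.
exists (N * N)%type, (fun nm => w nm.1 - w nm.2),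
  (fun nm => (a nm.1 * a nm.2)%:C%C * ((Z nm.1)^*%C * Z nm.2)); split.
  move=> t; pose u k : R[i] := expi (theta k * t) * (z k)^*%C.
  have monom (n : N) : \prod_k u k ^+ n k = expi (w n * t) * (Z n)^*%C.
    rewrite /w mulr_suml expi_sum rmorph_prod -big_split /=.
    by apply: eq_bigr => k _; rewrite exprMn rmorphXn -mulrA expiX.
  have u1 k : `|u k| = 1 by rewrite normrM norm_expi normcJ zT mulr1.
  suff : (peak theta z p t)%:C%C = \sum_nm
      (a nm.1 * a nm.2)%:C%C * ((Z nm.1)^*%C * Z nm.2)
      * expi ((w nm.1 - w nm.2) * t).
    by move=> /(congr1 (@complex.Re R)); rewrite Re_sum.
  transitivity (\prod_k ((1 + u k) / 2) ^+ p *
                (\prod_k ((1 + u k) / 2) ^+ p)^*%C).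
    rewrite !rmorph_prod -big_split /=; apply: eq_bigr => k _.
    by rewrite !rmorphXn /= -/(u k) half_angle// exprMn.
  rewrite prod_binomial rmorph_sum /= big_distrlr pair_big_dep /=.
  apply: eq_bigr => nm _.
  rewrite !monom !conjcM -/(a nm.1) -/(a nm.2).
  rewrite conjc_real conjcK conjc_expi mulrBl expiD.
  rewrite (rmorphM (real_complex R)) /=.
  by ring.
have diag nm : w nm.1 - w nm.2 == 0 ->
    complex.Re ((a nm.1 * a nm.2)%:C%C * ((Z nm.1)^*%C * Z nm.2))
    = a nm.1 * a nm.2.
  rewrite subr_eq0 => /eqP /zrel ZE; have -> : Z nm.2 = Z nm.1 by exact: esym.
  by rewrite [_^*%C * _]mulrC mul_conjc1// Re_mulC /= mulr1.
rewrite (eq_bigr (fun nm => a nm.1 * a nm.2)) //=.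
have -> : (p.+1 ^ r)%N = #|N| by rewrite card_ffun !card_ord.
apply: (le_trans (sum_sqr_ge_inv_card [ffun=> ord0] (sum_binomial_weights p))).
rewrite -/a [leRHS](bigID (fun nm => nm.1 == nm.2)) /=.
rewrite -[leLHS]addr0 lerD//; last first.
  by apply: sumr_ge0 => nm _; exact: mulr_ge0.
rewrite (reindex_onto (fun n : N => (n, n)) (fun nm => nm.1)) /=; last first.
  by move=> [n m] /= /andP[_ /eqP ->].
rewrite [leRHS](eq_bigl xpredT) => [|n]; last by rewrite subrr !eqxx.
exact: lexx.
Qed.
End Peak.

(** * Integrals of trigonometric sums *)

Section TrigIntegral.
Variable R : realType.
Local Notation mu := (@lebesgue_measure R).

Lemma FTC2_is_derive (f F : R -> R) (X : R) : 0 < X -> continuous f ->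
  (forall t : R, is_derive t 1 F (f t)) ->
  (\int[mu]_(t in `[0%R, X]) (f t)%:E = (F X - F 0)%:E)%E.
Proof.
move=> X0 cf dF.
have cF : continuous F.
  move=> t; apply: differentiable_continuous.
  by apply/derivable1_diffP; exact: ex_derive.
rewrite (@continuous_FTC2 _ f F)//.
- by apply: continuous_subspaceT.
- split.
  + by move=> t _; exact: ex_derive.
  + by apply: cvg_at_right_filter; exact: cF.
  + by apply: cvg_at_left_filter; exact: cF.
- by move=> t _; rewrite derive1E derive_val.
Qed.

Lemma is_derive_bigsum (I : Type) (s : seq I) (F f : I -> R -> R) (t : R) :
  (forall i, is_derive t 1 (F i) (f i t)) ->
  is_derive t 1 (fun x => \sum_(i <- s) F i x) (\sum_(i <- s) f i t).
Proof.
move=> dF; elim: s => [|i s IHs].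
  rewrite big_nil (_ : (fun _ => _) = cst 0); first exact: is_derive_cst.
  by apply/funext => x; rewrite big_nil.
rewrite big_cons (_ : (fun _ => _) = F i + (fun x => \sum_(i <- s) F i x)).
  exact: is_deriveD.
by apply/funext => x; rewrite big_cons.
Qed.

Lemma continuous_trig lam c : continuous (fun t : R =>
  complex.Re (c * expi (lam * t))).
Proof.
case: c => a b t; apply: cvgB; apply: cvgM; do ?exact: cvg_cst.
- apply: (@continuous_comp _ _ _ ( *%R lam) cos); last exact: continuous_cos.
  exact: mulrl_continuous.
- apply: (@continuous_comp _ _ _ ( *%R lam) sin); last exact: continuous_sin.
  exact: mulrl_continuous.
Qed.

Definition trig_primitive (lam : R) (c : R[i]) (t : R) : R :=
  if lam == 0 then complex.Re c * t
  else (complex.Re c * sin (lam * t) + complex.Im c * cos (lam * t)) / lam.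

Lemma is_derive_trig_primitive lam c (t : R) :
  is_derive t 1 (trig_primitive lam c) (complex.Re (c * expi (lam * t))).
Proof.
have dM (a : R) : is_derive t 1 (fun x : R => a * x) a.
  have := is_deriveZ a (is_derive_id t (1 : R)).
  by rewrite /GRing.scale /= mulr1.
rewrite /trig_primitive; case: eqVneq => [->|lam0].
  by rewrite mul0r expi0 mulr1; exact: dM.
have ds := is_derive1_comp (is_derive_sin (lam * t)) (dM lam).
have dc := is_derive1_comp (is_derive_cos (lam * t)) (dM lam).
have := is_deriveZ lam^-1
  (is_deriveD (is_deriveZ (complex.Re c) ds) (is_deriveZ (complex.Im c) dc)).
move=> d; have -> : (fun x => (complex.Re c * sin (lam * x) +
    complex.Im c * cos (lam * x)) / lam) = lam^-1 \*:
    (complex.Re c \*: (sin \o *%R lam) + complex.Im c \*: (cos \o *%R lam)).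
  by apply/funext => x /=; rewrite mulrC.
apply: (is_derive_eq d).
rewrite /GRing.scale /=; case: (c) => a b /=.
by field.
Qed.

Lemma trig_primitive_bounded lam c : lam != 0 ->
  exists B, forall t, `|trig_primitive lam c t| <= B.
Proof.
move=> lam0; exists ((`|complex.Re c| + `|complex.Im c|) / `|lam|) => t.
rewrite /trig_primitive (negbTE lam0) normrM normfV ler_wpM2r//.
rewrite (le_trans (ler_normD _ _))// !normrM.
by rewrite lerD// ler_piMr// ?sin_max ?cos_max.
Qed.

(** Constant terms integrate to multiples of X, and every other term has a
    bounded primitive, whose total oscillation is absorbed in C. *)
Lemma trig_sum_integral_ge (I : finType) (lam : I -> R) (c : I -> R[i]) :
  exists C, forall X, 0 < X ->
  ((X * \sum_(i | lam i == 0%R) complex.Re (c i) - C)%:E <=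
   \int[mu]_(t in `[0%R, X])
     (\sum_i complex.Re (c i * expi (lam i * t)))%:E)%E.
Proof.
have /choice[B HB] : forall i, exists B, lam i != 0 ->
    forall t, `|trig_primitive (lam i) (c i) t| <= B.
  move=> i; have [l0|l0] := eqVneq (lam i) 0; first by exists 0.
  by have [B HB] := trig_primitive_bounded (c i) l0; exists B.
exists (\sum_(i | lam i != 0) (B i + B i)) => X X0.
have dh (t : R) := @is_derive_bigsum _ (index_enum I)
  (fun i => trig_primitive (lam i) (c i))
  (fun i t => complex.Re (c i * expi (lam i * t))) t
  (fun i => is_derive_trig_primitive (lam i) (c i) t).
have ch : continuous (fun t : R => \sum_i complex.Re (c i * expi (lam i * t))).
  apply: continuous_big => [|i _]; last exact: continuous_trig.
  exact: add_continuous.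
rewrite (FTC2_is_derive X0 ch dh).
rewrite lee_fin -sumrB [leRHS](bigID (fun i => lam i == 0)) /= lerD//.
  rewrite mulr_sumr ler_sum// => i /eqP l0.
  by rewrite /trig_primitive l0 eqxx mulr0 subr0 mulrC.
rewrite -sumrN ler_sum// => i l0.
have := HB i l0 X; have := HB i l0 0; rewrite !ler_norml.
by move=> /andP[? ?] /andP[? ?]; lra.
Qed.
End TrigIntegral.

(** * Time spent near a point of the torus *)

Section Density.
Variable R : realType.
Local Notation mu := (@lebesgue_measure R).

(** Since q <= e^(-(1-q)), q^p is at most the (r+1)-st power of e^(-pb), with
    b = (1-q)/(r+1), and e^(pb) >= b (p+1).  So q^-p is at least
    b^(r+1) (p+1) times (p+1)^r, and that first factor exceeds 1 for large p. *)
Lemma geometric_lt_inv_polynomial (q : R) r : 0 <= q < 1 ->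
  exists p, q ^+ p < ((p.+1 ^ r)%:R)^-1.
Proof.
move=> /andP[q0 q1]; pose b := (1 - q) / r.+1%:R.
have b0 : 0 < b by rewrite divr_gt0// subr_gt0.
have b1 : b <= 1.
  by rewrite ler_pdivrMr// mul1r (@le_trans _ _ 1)// ?ler1n// gerBl.
have [p hp] : exists p : nat, b ^- r.+1 < p%:R.
  exists (Num.bound (b ^- r.+1)); apply: archi_boundP.
  by rewrite invr_ge0 exprn_ge0// ltW.
exists p.
have qp : q ^+ p <= (expR (p%:R * b) ^+ r.+1)^-1.
  apply: (@le_trans _ _ (expR (- (1 - q)) ^+ p)).
    rewrite lerXn2r ?nnegrE ?expR_ge0//.
    by have := expR_ge1Dx (- (1 - q)); rewrite opprB addrC subrK.
  rewrite -!expRM_natl -expRN ler_expR.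
  have -> : r.+1%:R * (p%:R * b) = p%:R * (1 - q).
    by rewrite mulrCA /b [_%:R * (_ / _)]mulrC divfK// pnatr_eq0.
  by rewrite mulrN.
apply: (le_lt_trans qp).
have bp : b * p.+1%:R <= expR (p%:R * b).
  apply: le_trans (expR_ge1Dx _).
  by rewrite -natr1 mulrDr mulr1 addrC mulrC lerD.
have bp0 : 0 < b * p.+1%:R by rewrite mulr_gt0.
rewrite ltf_pV2 ?posrE ?exprn_gt0 ?expR_gt0 ?ltr0n ?expn_gt0//.
apply: (@lt_le_trans _ _ ((b * p.+1%:R) ^+ r.+1)); last first.
  by rewrite lerXn2r ?nnegrE ?expR_ge0// ltW.
have -> : (b * p.+1%:R) ^+ r.+1 = (b ^+ r.+1 * p.+1%:R) * p.+1%:R ^+ r.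
  by rewrite exprMn -mulrA -exprS.
rewrite natrX ltr_pMl ?exprn_gt0// -ltr_pdivrMl ?exprn_gt0// mulr1.
by rewrite (lt_trans hp)// ltr_nat.
Qed.

(** Closeness is measured by the real part because
    |e^(ix) - z|^2 = 2 - 2 Re (e^(ix) conj(z)) and the peak function is built
    from that real part. *)
Definition near_times r (theta : 'I_r -> R) (z : 'I_r -> R[i]) (eta : R) :=
  [set t : R | forall k, 1 - eta < complex.Re (expi (theta k * t) * (z k)^*%C)].

Section FixedPoint.
Variables (r : nat) (theta : 'I_r -> R) (z : 'I_r -> R[i]).
Hypothesis zT : torus z.

Lemma peak_factor_bounds t k :
  0 <= (1 + complex.Re (expi (theta k * t) * (z k)^*%C)) / 2 <= 1.
Proof.
have : `|expi (theta k * t) * (z k)^*%C| = 1.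
  by rewrite normrM norm_expi normcJ zT mulr1.
by move=> /Re_norm_le1 /andP[? ?]; lra.
Qed.

Lemma peak_ge0 p t : 0 <= peak theta z p t.
Proof.
apply: prodr_ge0 => k _; apply: exprn_ge0.
by case/andP: (peak_factor_bounds t k).
Qed.

(** On [near_times] the indicator alone dominates; off it one factor is at most
    1 - eta/2 and the others at most 1. *)
Lemma peak_le eta p t : 0 < eta <= 1 ->
  peak theta z p t <= \1_(near_times theta z eta) t + (1 - eta / 2) ^+ p.
Proof.
move=> /andP[e0 e1].
have P01 k (_ : true) :
    0 <= ((1 + complex.Re (expi (theta k * t) * (z k)^*%C)) / 2) ^+ p <= 1.
  have /andP[? ?] := peak_factor_bounds t k.
  by rewrite exprn_ge0//= exprn_ile1.
have q0 : 0 <= 1 - eta / 2 by lra.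
rewrite indicE; have [tA|tA] := boolP (t \in near_times theta z eta) => /=.
  rewrite (@le_trans _ _ 1)// ?lerDl ?exprn_ge0//.
  exact: prodr_ile1.
rewrite add0r; move: tA; rewrite notin_setE /near_times /= => /existsNP[k].
move=> /negP; rewrite -leNgt => hk.
rewrite /peak (bigD1 k)//=.
rewrite -[leRHS]mulr1 ler_pM//.
- by case/andP: (P01 k isT).
- by apply: prodr_ge0 => j _; case/andP: (P01 j isT).
- rewrite lerXn2r ?nnegrE//; last by lra.
  by case/andP: (peak_factor_bounds t k).
- by apply: prodr_ile1 => j _; exact: P01.
Qed.

Lemma measurable_near_times eta :
  measurable (near_times theta z eta : set (measurableTypeR R)).
Proof.
rewrite (_ : near_times _ _ _ = \bigcap_(k in [set: 'I_r])
  [set t : R | 1 - eta < complex.Re (expi (theta k * t) * (z k)^*%C)]).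
  apply: fin_bigcap_measurable; first exact: finite_finset.
  move=> k _.
  apply: open_measurable; rewrite (_ : [set t | _] =
    (fun t => complex.Re ((z k)^*%C * expi (theta k * t))) @^-1` `]1 - eta, +oo[).
    apply: open_comp; last exact: interval_open.
    by move=> t _; exact: continuous_trig.
  by apply/seteqP; split=> t /=; rewrite in_itv/= andbT mulrC.
apply/seteqP; split => t /= tA k; first by move=> _; exact: tA.
exact: tA.
Qed.

(** Integrate [peak_le]: the left side has mean at least (p+1)^(-r), and p is
    chosen so that this exceeds the error term (1 - eta/2)^p. *)
Lemma near_times_lebesgue eta : 0 < eta <= 1 -> respects_relations theta z ->
  exists c C, 0 < c /\ forall X, 0 < X ->
    ((c * X - C)%:E <= mu (near_times theta z eta `&` `[0%R, X]))%E.
Proof.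
move=> eta01 zrel; have [p hp] : exists p, (1 - eta / 2) ^+ p < ((p.+1 ^ r)%:R)^-1.
  by apply: geometric_lt_inv_polynomial; lra.
have [I [lam [a [kE aM]]]] := peak_trig p zT zrel.
have [C HC] := trig_sum_integral_ge lam a.
have ck : continuous (peak theta z p).
  rewrite (funext kE); apply: continuous_big => [|i _]; last exact: continuous_trig.
  exact: add_continuous.
exists ((p.+1 ^ r)%:R^-1 - (1 - eta / 2) ^+ p), C.
split; first by rewrite subr_gt0.
move=> X X0.
have mA := measurable_near_times eta.
have q0 : 0 <= (1 - eta / 2) ^+ p by rewrite exprn_ge0//; lra.
have : (\int[mu]_(t in `[0%R, X]) (peak theta z p t)%:E <=
  \int[mu]_(t in `[0%R, X])
    ((\1_(near_times theta z eta) t)%:E + ((1 - eta / 2) ^+ p)%:E))%E.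
  apply: ge0_le_integral => //.
  - by move=> t _; rewrite lee_fin peak_ge0.
  - apply/measurable_EFinP; apply: measurable_funTS.
    exact: continuous_measurable_fun.
  - by apply: emeasurable_funD => //; apply/measurable_EFinP; exact: measurable_indic.
  - by move=> t _; rewrite -EFinD lee_fin peak_le.
rewrite ge0_integralD//=; last by apply/measurable_EFinP; exact: measurable_indic.
rewrite integral_indic// integral_cst//= lebesgue_measure_itv/= lte_fin X0.
rewrite sube0 -EFinM.
under eq_integral do rewrite kE.
move=> h; have {h} := le_trans (HC X X0) h.
rewrite -leeBlDr// -EFinB; apply: le_trans; rewrite lee_fin.
rewrite mulrBl addrAC lerB// lerB// mulrC ler_wpM2l//; exact: ltW.
Qed.
End FixedPoint.
End Density.

(** * Continuity of the values of a rational function *)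

Section Continuity.

Lemma cvg_meval (K : numFieldType) n (P : mpoly n K) (T : Type)
    (F : set_system T) (w : T -> 'I_n -> K) (z : 'I_n -> K) : Filter F ->
  (forall k, w t k @[t --> F] --> z k) ->
  meval (w t) P @[t --> F] --> meval z P.
Proof.
move=> FF wz; rewrite mevalE.
under eq_cvg do rewrite mevalE.
apply: cvg_big => [|m _]; first exact: add_continuous.
apply: cvgM; first exact: cvg_cst.
apply: cvg_big => [|k _]; first exact: mul_continuous.
by elim: (m k) => [|j IHj]; [exact: cvg_cst|
  under eq_cvg do rewrite exprS; rewrite exprS; exact: cvgM].
Qed.

(** Stated with norms rather than limits, so that it specializes to K = R[i]
    without choosing a topology on R[i]. *)
Lemma near_meval_quotient (K : numFieldType) n (P Q : mpoly n K) (T : Type)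
    (F : set_system T) (w : T -> 'I_n -> K) (z : 'I_n -> K) : Filter F ->
  (forall k e, 0 < e -> \forall t \near F, `|z k - w t k| < e) ->
  meval z Q != 0 -> forall e, 0 < e ->
  \forall t \near F, `|meval z P / meval z Q - meval (w t) P / meval (w t) Q| < e.
Proof.
move=> FF wz Qz; apply/cvgrPdist_lt.
have {}wz k : w t k @[t --> F] --> z k by apply/cvgrPdist_lt => e; exact: wz.
by apply: cvgM; [|apply: cvgV => //]; exact: cvg_meval.
Qed.

Variables (R : realType) (r : nat) (theta : 'I_r -> R) (z : 'I_r -> R[i]).
Hypothesis zT : torus z.

(** The filter of times at which the orbit is close to z: continuity at z then
    reads as convergence along it. *)
Definition near_filter : set_system R :=
  filter_from [set eta | 0 < eta <= 1] (near_times theta z).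

Lemma near_filter_filter : Filter near_filter.
Proof.
apply: filter_from_filter => [|a b /= /andP[a0 a1] /andP[b0 b1]].
  by exists 1; rewrite /= ltr01 lexx.
exists (Num.min a b); first by rewrite /= lt_min a0 b0 ge_min a1.
move=> t abt; split => k; apply: le_lt_trans (abt k);
  by rewrite lerB// ge_min lexx ?orbT.
Qed.
#[local] Existing Instance near_filter_filter.

Lemma near_filter_expi k (e : R[i]) : 0 < e ->
  \forall t \near near_filter, `|z k - expi (theta k * t)| < e.
Proof.
case: e => [e1 e2]; rewrite ltcE => /andP[/= /eqP-> {e2} e0].
exists (Num.min 1 (e1 ^+ 2 / 2)).
  by rewrite /= lt_min ltr01 divr_gt0 ?exprn_gt0//= ge_min lexx.
move=> t /(_ k) /= ht.
set u := expi _ in ht *.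
have e10 : 0 < e1%:C%C by rewrite (ltcR 0).
rewrite -[X in _ < X]/(e1%:C%C) -(@ltr_pXn2r _ 2)// ?nnegrE ?normr_ge0 ?ltW//.
rewrite sqr_normc.
have -> : (z k - u) * (z k - u)^*%C = (2 - 2 * complex.Re (u * (z k)^*%C))%:C%C.
  have -> : (z k - u)^*%C = (z k)^*%C - u^*%C by exact: rmorphB.
  transitivity (z k * (z k)^*%C + u * u^*%C
      - (u * (z k)^*%C + (u * (z k)^*%C)^*%C)).
    by rewrite conjcM conjcK; ring.
  rewrite addcJ !mul_conjc1 ?norm_expi ?zT//.
  by rewrite rmorphB rmorphM rmorph_nat.
rewrite -rmorphXn ltcR.
have : 1 - e1 ^+ 2 / 2 < complex.Re (u * (z k)^*%C).
  by apply: le_lt_trans ht; rewrite lerB// ge_min lexx orbT.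
by lra.
Qed.

Lemma along_near f e : no_pole_on_torus f -> 0 < e ->
  exists2 eta, 0 < eta <= 1 & forall t, near_times theta z eta t ->
    `|along theta f t - realval f z| < e.
Proof.
move=> [P [Q [fE Q0]]] e0.
have e0' : 0 < e%:C%C by rewrite (ltcR 0).
have [eta eta01 heta] :=
  near_meval_quotient P near_filter_filter near_filter_expi (Q0 z zT) e0'.
exists eta => // t /heta /=; rewrite /along /realval fE !ratvalE ?Q0//; last first.
  by move=> k; rewrite norm_expi.
move=> h; rewrite -(ltcR _ e); apply: le_lt_trans h.
rewrite distrC; apply: le_trans (normc_ge_Re _).
by rewrite raddfB.
Qed.
End Continuity.

(** * Points that respect the relations between the frequencies *)

Section Relations.
Variable R : realType.

Lemma orbit_respects_relations r (theta : 'I_r -> R) (y : R) :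
  respects_relations theta (fun k => expi (theta k * y)).
Proof.
move=> n m nm.
have prodE (l : 'I_r -> nat) : \prod_k expi (theta k * y) ^+ l k =
    expi ((\sum_k (l k)%:R * theta k) * y).
  by rewrite mulr_suml expi_sum; apply: eq_bigr => k _; rewrite -mulrA expiX.
by rewrite !prodE nm.
Qed.

(** The common denominator clears the denominator of each b_(k,j), so taking
    the numerator in [hcoef] loses nothing. *)
Lemma hcoefE m s (b : 'I_m -> 'I_s -> rat) k j :
  (hcoef b k j)%:~R = (common_denom b)%:R * b k j.
Proof.
have : (`|denq (b k j)| %| common_denom b)%N.
  by apply: (@biglcmn_sup _ k) => //; exact: (@biglcmn_sup _ j).
move=> /dvdnP[c dE]; rewrite /hcoef.
have -> : (common_denom b)%:R * b k j = (c%:Z * numq (b k j))%:~R.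
  rewrite intrM numqE dE natrM -mulrA [b k j * _]mulrC; congr (_ * (_ * _)).
  by rewrite -[in RHS](absz_denq (b k j)).
by rewrite numq_int.
Qed.

Lemma prod_exprz_sum (K : fieldType) (I : finType) (x : K) (e : I -> int) :
  x != 0 -> x ^ (\sum_i e i) = \prod_i x ^ e i.
Proof.
by move=> x0; apply: (big_morph _ (id1 := 1)) => // a b; exact: expfzDr.
Qed.

Lemma torus_neq0 n (w : 'I_n -> R[i]) k : torus w -> w k != 0.
Proof. by move=> wT; rewrite -normr_eq0 wT oner_eq0. Qed.

Section Reindexing.
Variables (r m s : nat) (theta : 'I_r -> R) (sigma : 'I_(m + s) -> 'I_r).
Variables (b : 'I_m -> 'I_s -> rat) (z : 'I_r -> R[i]).
Hypothesis zH : Htheta sigma b z.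

Lemma Htheta_torus : bijective sigma -> torus z.
Proof.
move=> [tau _ tauK] i; rewrite -(tauK i).
have [w wT [zl zr]] := zH.
have [k ->|j ->] := split_ordP (tau i).
  by rewrite zl normrX wT expr1n.
rewrite zr normr_prod big1// => k _.
by case: (hcoef b k j) => l; rewrite /exprz ?normfV normrX wT expr1n ?invr1.
Qed.

(** The exponent of w_k in the monomial of z with exponents n. *)
Let expo (n : 'I_r -> nat) k : int :=
  (n (sigma (lshift s k)) * common_denom b)%:Z +
  \sum_j (n (sigma (rshift m j)))%:Z * hcoef b k j.

(** The exponent of w_k in a monomial of z is d times the k-th coordinate, in
    the basis of the first m frequencies, of the corresponding combination of
    the theta_i.  Equal combinations have equal coordinates, hence equal
    monomials. *)
Lemma Htheta_respects_relations :
  Qbasis_reindexing theta sigma b -> respects_relations theta z.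
Proof.
move=> [sigma_bij free _ thetaE] n n' nn'.
have [w wT [zl zr]] := zH.
have monomE (l : 'I_r -> nat) : \prod_i z i ^+ l i = \prod_k w k ^ expo l k.
  rewrite (reindex sigma) /=; last exact: onW_bij.
  rewrite big_split_ord /=.
  under [X in _ * X = _]eq_bigr => j _ do
    rewrite zr -prodrXl; rewrite [X in _ * X = _]exchange_big -big_split /=.
  apply: eq_bigr => k _; rewrite expfzDr ?torus_neq0//.
  rewrite prod_exprz_sum ?torus_neq0// zl -exprM mulnC; congr (_ * _).
  by apply: eq_bigr => j _; rewrite exprnP exprz_exp mulrC.
rewrite !monomE; apply: eq_bigr => k _; congr (_ ^ _).
pose coord (l : 'I_r -> nat) k : rat := (l (sigma (lshift s k)))%:R +
  \sum_j (l (sigma (rshift m j)))%:R * b k j.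
have expoE l : (expo l k)%:~R = (common_denom b)%:R * coord l k.
  rewrite /expo /coord intrD mulrDr -pmulrn natrM [_ * (common_denom b)%:R]mulrC.
  congr (_ + _).
  rewrite rmorph_sum mulr_sumr; apply: eq_bigr => j _.
  by rewrite /= intrM hcoefE mulrCA.
have freqE (l : 'I_r -> nat) : \sum_i (l i)%:R * theta i =
    \sum_k ratr (coord l k) * theta (sigma (lshift s k)).
  rewrite (reindex sigma) /=; last exact: onW_bij.
  rewrite big_split_ord /=.
  under [X in _ + X = _]eq_bigr => j _ do rewrite thetaE mulr_sumr.
  rewrite [X in _ + X = _]exchange_big -big_split; apply: eq_bigr => k' _.
  rewrite /coord rmorphD /= mulrDl ratr_nat; congr (_ + _).
  rewrite rmorph_sum mulr_suml; apply: eq_bigr => j _.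
  by rewrite rmorphM /= ratr_nat mulrA.
have : coord n k = coord n' k.
  apply/eqP; rewrite -subr_eq0; apply/eqP.
  apply: (free (fun k => coord n k - coord n' k)).
  under eq_bigr do rewrite rmorphB mulrBl.
  by rewrite sumrB -!freqE nn' subrr.
move=> cE; apply: (intr_inj (R := rat)).
by rewrite !expoE cE.
Qed.
End Reindexing.
End Relations.

(** * Densities for the completed Lebesgue measure *)

Section CompletedDensity.
Variable R : realType.
Local Notation mu := (@lebesgue_measure R).
Local Notation cmu := (@completed_lebesgue_measure R).

(** Both measures are restrictions of the same outer measure, so their values on
    Borel sets are exchanged by conversion. *)
Lemma completed_lebesgue_itv (X : R) : 0 <= X -> cmu `[0%R, X] = X%:E.
Proof.
move=> X0; change (cmu `[0%R, X]) with (mu `[0%R, X]).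
rewrite lebesgue_measure_itv/= lte_fin; case: ltP; first by rewrite sube0.
by move=> X0'; rewrite (_ : X = 0)//; apply/eqP; rewrite eq_le X0 X0'.
Qed.

Lemma measurable_itv_completed (X : R) :
  measurable (`[0%R, X] : set (lebesgueR R)).
Proof.
by apply: sub_caratheodory; exact: (@measurable_itv R `[0, X]).
Qed.

Variables (r : nat) (theta : 'I_r -> R) (z : 'I_r -> R[i]) (eta : R).
Hypotheses (zT : torus z) (zrel : respects_relations theta z).
Hypothesis eta01 : 0 < eta <= 1.

(** Requiring the inclusion only for large times loses a bounded initial
    segment, whose length is negligible after division by X. *)
Lemma eventual_near_times_measure (E : set (lebesgueR R)) :
  (\forall t \near +oo, near_times theta z eta t -> E t) ->
  exists2 c : R, 0 < c & \forall X \near +oo,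
    (c%:E <= (X^-1)%:E * cmu (E `&` `[0%R, X]))%E.
Proof.
move=> [T [_ hT]].
have [c [C [c0 hC]]] := near_times_lebesgue zT eta01 zrel.
pose T1 := Num.max T 0; have T10 : 0 <= T1 by rewrite le_max lexx orbT.
exists (c / 2); first by rewrite divr_gt0.
exists (Num.max 0 ((C + T1) / (c / 2))); split; first exact: num_real.
move=> X; rewrite gt_max => /andP[X0 hX].
have key : ((c * X - C)%:E <= cmu (E `&` `[0%R, X]) + T1%:E)%E.
  apply: (le_trans (hC X X0)).
  rewrite -(completed_lebesgue_itv T10).
  apply: le_trans; last exact: outer_measureU2.
  apply: le_outer_measure => t /= [tA tX].
  have [tT|tT] := leP t T1.
    by right; rewrite in_itv/= tT andbT; case/andP: tX.
  by left; split=> //; apply: hT => //; move: tT; rewrite gt_max => /andP[].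
rewrite -(@lee_pmul2l _ X%:E) ?lte_fin// muleA.
rewrite -[(X%:E * _)%E in leRHS]EFinM divff ?gt_eqF// mul1e.
rewrite -leeBlDr// -EFinB in key.
apply: le_trans key; rewrite -EFinM lee_fin.
rewrite ltr_pdivrMr ?divr_gt0// in hX.
by lra.
Qed.
End CompletedDensity.

Section Densities.
Variables (R : realType) (D : nat) (G : R -> 'I_D -> R).
Local Notation cmu := (@completed_lebesgue_measure R).
Hypothesis G_meas : forall j, lebesgue_measurable (fun t => G t j).

Lemma measurable_decr : measurable ([set t | decr (G t)] : set (lebesgueR R)).
Proof.
rewrite (_ : [set t | _] = \bigcap_(ij in [set ij : 'I_D * 'I_D |
    ij.2 = ij.1.+1 :> nat]) [set t | G t ij.2 < G t ij.1]).
  apply: fin_bigcap_measurable; first exact: finite_finset.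
  move=> [i j] _ /=.
  have := measurable_fun_ltr (G_meas j) (G_meas i).
  move=> /(_ measurableT [set true] I); rewrite setTI.
  by congr measurable.
apply/seteqP; split => [t dt [i j] /= ij|t dt i j ij]; first exact: dt.
exact: (dt (i, j) ij).
Qed.

Lemma mean_decrE X : mean_decr G X =
  ((X^-1)%:E * cmu ([set t | decr (G t)] `&` `[0%R, X]))%E.
Proof.
rewrite /mean_decr integral_indic//; first exact: measurable_itv_completed.
exact: measurable_decr.
Qed.

Lemma mean_decr_compl X : 0 < X -> (mean_decr G X +
  (X^-1)%:E * cmu (~` [set t | decr (G t)] `&` `[0%R, X]) = 1)%E.
Proof.
move=> X0; rewrite mean_decrE -ge0_muleDr ?lee_fin ?invr_ge0 ?(ltW X0)//.
rewrite ![_ `&` `[_, _]]setIC addeC -setDE -measureDI//.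
- transitivity ((X^-1)%:E * X%:E)%E.
    by congr (_ * _)%E; apply: completed_lebesgue_itv; exact: ltW.
  by rewrite -EFinM mulVf// gt_eqF.
- exact: measurable_itv_completed.
- exact: measurable_decr.
Qed.

Lemma lower_density_gt0 (c : R) : 0 < c ->
  (\forall X \near +oo, (c%:E <= mean_decr G X)%E) -> (0 < lower_density G)%E.
Proof.
move=> c0 hc; apply: (@lt_le_trans _ _ c%:E); first by rewrite lte_fin.
rewrite /lower_density limf_einfE.
pose V := [set X | (c%:E <= mean_decr G X)%E].
apply: (@le_trans _ _ (ereal_inf (mean_decr G @` V))).
  by apply: le_ereal_inf_tmp => _ [X hX <-].
by apply: ereal_sup_ubound; exists V.
Qed.

Lemma upper_density_lt1 (c : R) : 0 < c ->
  (\forall X \near +oo, (mean_decr G X <= (1 - c)%:E)%E) ->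
  (upper_density G < 1)%E.
Proof.
move=> c0 hc; apply: (@le_lt_trans _ _ (1 - c)%:E).
  rewrite /upper_density limf_esupE.
  pose V := [set X | (mean_decr G X <= (1 - c)%:E)%E].
  apply: (@le_trans _ _ (ereal_sup (mean_decr G @` V))).
    by apply: ereal_inf_lbound; exists V.
  by apply: ge_ereal_sup => _ [X hX <-].
by rewrite lte_fin ltrBlDr ltrDl.
Qed.
End Densities.

(** * Order of the values near a point of the torus *)

Section OrderNearPoint.
Variables (R : realType) (r D : nat) (theta : 'I_r -> R).
Variables (f : 'I_D -> ratfun R r) (G : R -> 'I_D -> R).
Hypothesis f_no_pole : forall j, no_pole_on_torus (f j).
Hypothesis G_asymp : forall j,
  (fun t : R => G t j - along theta (f j) t) @ +oo --> (0 : R).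
Variable z : 'I_r -> R[i].
Hypothesis zT : torus z.

(** The error e is shared equally between G_j(t) - F_j(t), small for large t, and
    F_j(t) - f_j(z), small for t near z. *)
Lemma asymp_near (e : R) : 0 < e -> exists2 eta, 0 < eta <= 1 &
  \forall t \near +oo, near_times theta z eta t ->
    forall j, `|G t j - realval (f j) z| < e.
Proof.
move=> e0; have e20 : 0 < e / 2 by rewrite divr_gt0.
have /choice[eta heta] : forall j, exists eta, 0 < eta <= 1 /\
    forall t, near_times theta z eta t ->
      `|along theta (f j) t - realval (f j) z| < e / 2.
  by move=> j; have [eta ? ?] := along_near theta zT (f_no_pole j) e20; exists eta.
have eta1 j := (heta j).1.
exists (\big[Num.min/1]_j eta j).
  rewrite bigmin_le_id andbT; apply/bigmin_gtP; split=> // j _.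
  by case/andP: (eta1 j).
have Gnear : \forall t \near +oo, forall j,
    `|G t j - along theta (f j) t| < e / 2.
  apply: filter_forall => j.
  by have /cvgr0Pnorm_lt := G_asymp j; apply.
apply: filterS Gnear => t hG tA j.
rewrite -(subrKA (along theta (f j) t)) (le_lt_trans (ler_normD _ _))//.
rewrite [e]splitr ltrD//; apply: (heta j).2 => k.
by apply: le_lt_trans (tA k); rewrite lerB// bigmin_le.
Qed.

Hypothesis G_meas : forall j, lebesgue_measurable (fun t => G t j).
Hypothesis zrel : respects_relations theta z.

Lemma decr_lower_density :
  decr (fun j => realval (f j) z) -> (0 < lower_density G)%E.
Proof.
move=> dz.
have [e e0 he] : exists2 e : R, 0 < e & forall i j : 'I_D, j = i.+1 :> nat ->
    e + e <= realval (f i) z - realval (f j) z.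
  pose gap (ij : 'I_D * 'I_D) := realval (f ij.1) z - realval (f ij.2) z.
  (* Half the smallest gap between consecutive values; the bound 1 serves when
     there are no consecutive indices. *)
  exists ((\big[Num.min/1]_(ij : 'I_D * 'I_D | ij.2 == ij.1.+1 :> nat) gap ij) / 2).
    rewrite divr_gt0//; apply/bigmin_gtP; split=> // -[i j] /= /eqP ij.
    by rewrite subr_gt0; exact: dz.
  move=> i j /eqP ij; rewrite -splitr.
  exact: (@bigmin_le_cond _ _ _ _ (i, j)).
have [eta eta01 hA] := asymp_near e0.
have hE : \forall t \near +oo, near_times theta z eta t ->
    [set t | decr (G t)] t.
  apply: filterS hA => t /[apply] ht i j ij.
  have := ht i; have := ht j; have := he i j ij; rewrite !ltr_norml.
  by move=> ? /andP[? ?] /andP[? ?]; lra.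
have [c c0 hc] := eventual_near_times_measure zT zrel eta01 hE.
apply: (lower_density_gt0 c0); apply: filterS hc => X.
by rewrite mean_decrE.
Qed.

Lemma not_nonincr_upper_density :
  ~ nonincr (fun j => realval (f j) z) -> (upper_density G < 1)%E.
Proof.
move=> nz.
have [i ni] := (existsNP _).2 nz.
have [j nij] := (existsNP _).2 ni.
move: nij => /not_implyP[ij] /negP; rewrite -ltNge => fij.
pose e := (realval (f j) z - realval (f i) z) / 2.
have e0 : 0 < e by rewrite divr_gt0// subr_gt0.
have [eta eta01 hA] := asymp_near e0.
have hE : \forall t \near +oo, near_times theta z eta t ->
    (~` [set t | decr (G t)]) t.
  apply: filterS hA => t /[apply] ht /(_ i j ij).
  have := ht i; have := ht j; rewrite !ltr_norml /e => /andP[? ?] /andP[? ?].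
  by lra.
have [c c0 hc] := eventual_near_times_measure zT zrel eta01 hE.
apply: (upper_density_lt1 c0).
near=> X.
have X0 : 0 < X by near: X; exact: nbhs_pinfty_gt.
have cX : (c%:E <= (X^-1)%:E * completed_lebesgue_measure
  (~` [set t | decr (G t)] `&` `[0%R, X]))%E by near: X.
by rewrite EFinB leeBrDr// -(mean_decr_compl G_meas X0) leeD2l.
Unshelve. all: by end_near.
Qed.
End OrderNearPoint.

Theorem proposition3p4 (R : realType) (r D : nat) (theta : 'I_r -> R)
    (f : 'I_D -> ratfun R r) (G : R -> 'I_D -> R)
    (f_distinct : injective f)
    (f_no_pole : forall j, no_pole_on_torus (f j))
    (f_real : forall j, real_on_torus (f j))
    (G_meas : forall j, lebesgue_measurable (fun t => G t j))
    (G_asymp : forall j,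
       (fun t : R => G t j - along theta (f j) t) @ +oo --> (0 : R)) :
  (forall (m s : nat) (sigma : 'I_(m + s) -> 'I_r) (b : 'I_m -> 'I_s -> rat),
     Qbasis_reindexing theta sigma b ->
     ((exists2 z, Htheta sigma b z & decr (fun j => realval (f j) z)) ->
        (0 < lower_density G)%E) /\
     ((exists2 z, Htheta sigma b z & ~ nonincr (fun j => realval (f j) z)) ->
        (upper_density G < 1)%E)) /\
  ((exists y : R, decr (fun j => along theta (f j) y)) ->
     (0 < lower_density G)%E) /\
  ((exists n : int, ~ nonincr (fun j => along theta (f j) n%:~R)) ->
     (upper_density G < 1)%E).
Proof.
have orbit_torus y : torus (fun k => expi (theta k * y)).
  by move=> k; exact: norm_expi.
split=> [m s sigma b basis|].
  have [sigma_bij _ _ _] := basis.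
  split=> -[z zH fz]; [apply: (@decr_lower_density _ _ _ theta f _ _ _ z) |
    apply: (@not_nonincr_upper_density _ _ _ theta f _ _ _ z)] => //.
  - exact: Htheta_torus zH sigma_bij.
  - exact: Htheta_respects_relations zH basis.
  - exact: Htheta_torus zH sigma_bij.
  - exact: Htheta_respects_relations zH basis.
split=> [[y fy]|[n fn]].
  apply: (decr_lower_density f_no_pole G_asymp (orbit_torus y) G_meas _ fy).
  exact: orbit_respects_relations.
apply: (not_nonincr_upper_density f_no_pole G_asymp (orbit_torus n%:~R) G_meas
  _ fn).
exact: orbit_respects_relations.
Qed.
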